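(* Let $r\ge 1$ be an integer and $0\le\epsilon<1$. Consider any perturbation $\hat V$ with strength $\epsilon$ and range $r$. Let $E_0^\uparrow\le E_1^\uparrow\le E_2^\uparrow$ be the three lowest eigenvalues, counted with multiplicity, of $\hat H_0+\hat V$. Then for all sufficiently large $N$, $$E_1^\uparrow-E_0^\uparrow\le\Big(\frac{2\epsilon}{1+\epsilon}\Big)^{\frac{N}{2r}}\qquad\text{and}\qquad E_2^\uparrow-E_1^\uparrow\ge 1-\epsilon-\Big(\frac{2\epsilon}{1+\epsilon}\Big)^{\frac{N}{2r}}.$$
   Context: Fix an integer $N\ge 2$. Let $c_1,\dots,c_{2N}$ be Majorana operators on the $2^N$-dimensional fermionic Fock space of $N$ modes. These are self-adjoint operators with $c_pc_q+c_qc_p=2\delta_{p,q}I$. Concretely, via the Jordan–Wigner map on $N$ qubits, $c_{2j-1}=Z_1\cdots Z_{j-1}X_j$ and $c_{2j}=Z_1\cdots Z_{j-1}Y_j$. The unperturbed Hamiltonian is $\hat H_0=\frac{i}{2}\sum_{j=1}^{N-1}c_{2j}c_{2j+1}$. A perturbation is an operator $\hat V=\frac{i}{4}\sum_{p,q=1}^{2N}V_{p,q}c_pc_q$, where $V$ is a real antisymmetric $2N\times 2N$ matrix. The perturbation has strength $\epsilon$ if $\|V\|\le\epsilon$ (operator norm of the matrix $V$). It has range $r$ if $V_{p,q}=0$ whenever $|p-q|>r$. *)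

(* Defs.v *)
From HB Require Import structures.
From mathcomp Require Import all_boot all_order all_algebra.
Set Implicit Arguments. Unset Strict Implicit. Unset Printing Implicit Defensive.
Import Order.TTheory GRing.Theory Num.Theory.
Local Open Scope ring_scope.

Definition real_complete (C : numClosedFieldType) : Prop :=
  forall P : C -> Prop,
    (forall x, P x -> x \is Num.real) ->
    (exists x, P x) ->
    (exists b, b \is Num.real /\ forall x, P x -> x <= b) ->
    exists s, s \is Num.real /\ (forall x, P x -> x <= s) /\
              (forall b, (forall x, P x -> x <= b) -> s <= b).

(* bit l of the natural number n; qubit number l+1 (1-indexed) of the
   computational basis state |n> of N qubits is  bitn l n. *)
Definition bitn (l n : nat) : bool := odd (n %/ 2 ^ l).

(* Majorana operator c_{p+1} (p is 0-based, p < 2N) via Jordan--Wigner: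
   c_{2k+1} = Z_1..Z_k X_{k+1},  c_{2k+2} = Z_1..Z_k Y_{k+1}  (k 0-based site).
   Entry (a,b) is <a| c |b>;  X|b> = |b xor e_k>,  Y|b> = i(-1)^{b_k}|b xor e_k>,
   Z_l|b> = (-1)^{b_l}|b>. *)
Definition majorana (C : numClosedFieldType) (N p : nat) : 'M[C]_(2 ^ N) :=
  \matrix_(a < 2 ^ N, b < 2 ^ N)
    (let k := p./2 in
     if [forall l : 'I_N, (bitn l a == bitn l b) == (val l != k)] then
       (-1) ^+ (\sum_(l < N | (l < k)%N) bitn l b)%N *
       (if odd p then 'i * (-1) ^+ bitn k b else 1)
     else 0).

(* H_0 = (i/2) sum_{j=1}^{N-1} c_{2j} c_{2j+1}  (0-based: c at 2j'+1, 2j'+2). *)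
Definition H0 (C : numClosedFieldType) (N : nat) : 'M[C]_(2 ^ N) :=
  ('i / 2) *: \sum_(j < N.-1) (majorana C N (2 * j + 1) *m majorana C N (2 * j + 2)).

Definition hatV (C : numClosedFieldType) (N : nat) (V : 'M[C]_(2 * N)) : 'M[C]_(2 ^ N) :=
  ('i / 4) *: \sum_(p < 2 * N) \sum_(q < 2 * N) (V p q *: (majorana C N p *m majorana C N q)).

Definition Ham (C : numClosedFieldType) (N : nat) (V : 'M[C]_(2 * N)) : 'M[C]_(2 ^ N) :=
  H0 C N + hatV V.

Definition real_antisym (C : numClosedFieldType) (n : nat) (V : 'M[C]_n) : Prop :=
  (forall p q, V p q \is Num.real) /\ V^T = - V.

Definition vnorm (C : numClosedFieldType) (n : nat) (x : 'cV[C]_n) : C :=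
  sqrtC (\sum_(i < n) `|x i 0| ^+ 2).

Definition opnorm_le (C : numClosedFieldType) (n : nat) (V : 'M[C]_n) (eps : C) : Prop :=
  forall x : 'cV[C]_n, vnorm (V *m x) <= eps * vnorm x.

Definition has_range (C : numClosedFieldType) (n : nat) (V : 'M[C]_n) (r : nat) : Prop :=
  forall p q : 'I_n, (p + r < q)%N || (q + r < p)%N -> V p q = 0.

Definition sorted_eigenvalues (C : numClosedFieldType) (n : nat) (A : 'M[C]_n)
    (E : nat -> C) : Prop :=
  char_poly A = \prod_(i < n) ('X - (E i)%:P) /\
  (forall i j : nat, (i <= j)%N -> (j < n)%N -> E i <= E j).

(* Main.v *)
Require Import Defs.
From HB Require Import structures.
From mathcomp Require Import all_boot all_order all_algebra.
From mathcomp Require Import perm spectral zify ring.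
Set Implicit Arguments. Unset Strict Implicit. Unset Printing Implicit Defensive.
Import Order.TTheory GRing.Theory Num.Theory.
Local Open Scope ring_scope.
Local Open Scope sesquilinear_scope.

(** In the Majorana picture [Ham V] is the quadratic Hamiltonian of the real
    antisymmetric matrix [A = A0 + V], where [A0] (called [chain] below) has
    kernel spanned by [e_0] and [e_(2N-1)] and squares to [-1] on their
    orthogonal complement.  For [c(v) = sum_p v_p c_p] one has
    [[Ham V, c(v)] = i c(A v)].

    First gap: the truncated Neumann series [v = sum_(k <= m) (A0 V)^k e_0] is
    real and satisfies [A v = V (A0 V)^m e_0] as long as the range of [V] does
    not connect the two ends of the chain, so [|A v| <= eps^(m+1) |v|].  Either
    the ground state is degenerate, or it has a definite fermion parity; in the
    latter case the parity-odd operator [c(v)] sends it to an orthogonal state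
    whose energy is off by at most [|A v| / |v|].

    Second gap: [i A0] has eigenvalue [1] with multiplicity [N - 1], so [i A] has
    [N - 1] orthonormal eigenvectors [u_j] with eigenvalues at least [1 - eps].
    The adjoint of each [c(u_j)] lowers the energy by at least [1 - eps], hence
    annihilates every eigenstate below [E_0 + 1 - eps].  The joint kernel of these
    [N - 1] operators has dimension at most [2]. *)

Lemma adjmxE (C : numClosedFieldType) m n (A : 'M[C]_(m, n)) i j :
  (A ^t* ) i j = (A j i)^*.
Proof. by rewrite !mxE. Qed.

(** * Binary digits of basis indices and single-bit flips *)

Lemma bitnS (l a : nat) : bitn l.+1 a = bitn l a./2.
Proof. by rewrite /bitn expnS -divn2 divnMA. Qed.

Lemma bitn_inj (N a b : nat) : (a < 2 ^ N)%N -> (b < 2 ^ N)%N ->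
  (forall l, (l < N)%N -> bitn l a = bitn l b) -> a = b.
Proof.
elim: N a b => [|N IH] a b; first by rewrite expn0; lia.
rewrite expnS => ha hb hab.
have h0 : odd a = odd b by have := hab 0%N isT; rewrite /bitn expn0 !divn1.
rewrite -(odd_double_half a) -(odd_double_half b) h0; congr (_ + _.*2)%N.
apply: IH; [lia|lia|] => l hl.
by rewrite -!bitnS hab.
Qed.

(** The flipped index is found by search, so that it can be handled through its bits alone. The
    default [b] is never reached, as the proof of [bitn_flip] shows. *)
Definition flip (N k : nat) (b : 'I_(2 ^ N)) : 'I_(2 ^ N) :=
  odflt b [pick a : 'I_(2 ^ N) |
            [forall l : 'I_N, bitn l a == bitn l b (+) (val l == k)]].

Lemma ord_bitn_inj (N : nat) (a b : 'I_(2 ^ N)) :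
  (forall l : 'I_N, bitn l a = bitn l b) -> a = b.
Proof.
move=> h; apply: val_inj; apply: (@bitn_inj N) (ltn_ord a) (ltn_ord b) _ => l hl.
exact: (h (Ordinal hl)).
Qed.

(** Sending an index to its bit string is injective between two sets of size [2 ^ N], hence
    bijective, so the search in [flip] succeeds. *)
Lemma bitn_flip (N k : nat) (b : 'I_(2 ^ N)) (l : 'I_N) :
  bitn l (flip k b) = bitn l b (+) (val l == k).
Proof.
rewrite /flip; case: pickP => [a /forallP/(_ l)/eqP //|noa].
pose bits (a : 'I_(2 ^ N)) := [ffun l : 'I_N => bitn l a].
have bits_inj : injective bits.
  by move=> x y /ffunP h; apply: ord_bitn_inj => i; have := h i; rewrite !ffunE.
have [g gK Kg] : bijective bits.
  by apply: inj_card_bij bits_inj _; rewrite card_ffun !card_ord card_bool.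
have /negP[] := noa (g [ffun l : 'I_N => bitn l b (+) (val l == k)]).
apply/forallP => i; have := congr1 (fun f : {ffun _ -> _} => f i)
  (Kg [ffun l : 'I_N => bitn l b (+) (val l == k)]).
by rewrite !ffunE => ->.
Qed.

Lemma flipK (N k : nat) : involutive (@flip N k).
Proof. by move=> b; apply: ord_bitn_inj => l; rewrite !bitn_flip addbK. Qed.

Lemma flipC (N j k : nat) (b : 'I_(2 ^ N)) :
  flip j (flip k b) = flip k (flip j b).
Proof. by apply: ord_bitn_inj => l; rewrite !bitn_flip addbAC. Qed.

(** * Jordan-Wigner operators: anticommutation, self-adjointness, fermion parity *)

Section Majorana.
Variables (C : numClosedFieldType) (N : nat).

Definition jw_sign (k : nat) (b : 'I_(2 ^ N)) : C :=
  (-1) ^+ (\sum_(l < N | (l < k)%N) bitn l b)%N.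

Definition jw_phase (p : nat) (b : 'I_(2 ^ N)) : C :=
  jw_sign p./2 b * (if odd p then 'i * (-1) ^+ bitn p./2 b else 1).

Lemma jw_sign_flip (k j : nat) (b : 'I_(2 ^ N)) : (j < N)%N ->
  jw_sign k (flip j b) = (-1) ^+ (j < k)%N * jw_sign k b.
Proof.
move=> hj; rewrite /jw_sign !expr_sum.
under eq_bigr => l _ do rewrite bitn_flip signr_addb.
rewrite big_split /= mulrC; congr (_ * _).
rewrite big_mkcond (bigD1 (Ordinal hj)) //= eqxx big1 ?mulr1; first by case: ifP.
by move=> i /negPf; rewrite -val_eqE /= => ->; case: ifP.
Qed.

Lemma majoranaE (p : nat) (a b : 'I_(2 ^ N)) :
  majorana C N p a b = (a == flip p./2 b)%:R * jw_phase p b.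
Proof.
rewrite mxE /=; set P := [forall l, _].
suff -> : P = (a == flip p./2 b) by case: eqP => _; rewrite ?mul1r ?mul0r.
apply/forallP/eqP => [h|-> l]; last by rewrite bitn_flip; case: eqP; case: bitn.
apply: ord_bitn_inj => l; rewrite bitn_flip; have := h l.
by case: (val l == _); case: (bitn l a); case: (bitn l b).
Qed.

(** A sign appears when the flipped site lies in the Z-string of [c_p], or is the site of [c_p]
    itself and [c_p] is of Y type ([p] odd). *)
Lemma jw_phase_flip (p q : nat) (b : 'I_(2 ^ N)) :
  (p < 2 * N)%N -> (q < 2 * N)%N ->
  jw_phase p (flip q./2 b) =
    (-1) ^+ ((q./2 < p./2)%N || (q./2 == p./2) && odd p) * jw_phase p b.
Proof.
move=> hp hq; have hq2 : (q./2 < N)%N by lia.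
have hp2 : (p./2 < N)%N by lia.
rewrite /jw_phase jw_sign_flip // -!mulrA.
have -> : bitn p./2 (flip q./2 b) = bitn p./2 b (+) (p./2 == q./2).
  exact: (bitn_flip q./2 b (Ordinal hp2)).
rewrite (eq_sym q./2); case: (odd p); last by rewrite andbF orbF.
rewrite andbT signr_addb; case: ltngtP => h /=; rewrite ?expr1 ?expr0; ring.
Qed.

Lemma majorana_mulE (p q : nat) (a b : 'I_(2 ^ N)) :
  (majorana C N p *m majorana C N q) a b =
  (a == flip p./2 (flip q./2 b))%:R * (jw_phase p (flip q./2 b) * jw_phase q b).
Proof.
rewrite mxE (bigD1 (flip q./2 b)) //= !majoranaE eqxx mul1r big1 ?addr0 ?mulrA //.
by move=> i /negPf; rewrite !majoranaE => ->; rewrite mul0r mulr0.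
Qed.

Lemma jw_sign_sqr (k : nat) (b : 'I_(2 ^ N)) : jw_sign k b * jw_sign k b = 1.
Proof. by rewrite /jw_sign -expr2 sqrr_sign. Qed.

Lemma majorana_anticomm (p q : nat) : (p < 2 * N)%N -> (q < 2 * N)%N ->
  majorana C N p *m majorana C N q + majorana C N q *m majorana C N p
  = (2 * (p == q)%:R)%:M.
Proof.
move=> hp hq; apply/matrixP => a b.
rewrite mxE !majorana_mulE !jw_phase_flip // flipC [RHS]mxE.
case: (eqVneq p q) => [<-|npq].
  rewrite flipK eqxx ltnn /= mulr1; case: (eqVneq a b) => _; last by rewrite !mul0r addr0.
  rewrite mulr1n mul1r /jw_phase; have h1 := jw_sign_sqr p./2 b.
  have h2 : 'i * 'i = -1 :> C by rewrite -expr2 sqrCi.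
  have h3 : (-1) ^+ bitn p./2 b * (-1) ^+ bitn p./2 b = 1 :> C.
    by rewrite -expr2 sqrr_sign.
  move: h1 h3; set s := jw_sign _ _; set t := (-1) ^+ bitn _ _ => h1 h3.
  case: (odd p); rewrite ?expr1 ?expr0; last by rewrite mulr1n !mulr1 mul1r h1.
  have -> : -1 * (s * ('i * t)) * (s * ('i * t)) = - ((s * s) * ('i * 'i) * (t * t)).
    by ring.
  by rewrite h1 h2 h3 mulr1n; ring.
rewrite mulr0 mul0rn (eq_sym p./2 q./2).
set x := (_ || _ && odd p); set y := (_ || _ && odd q).
(* Exactly one of the two orders picks up a sign: on distinct sites only the operator further right
   has a string crossing the other; on a common site [p] and [q] differ in parity. *)
have -> : y = ~~ x by rewrite /x /y; lia.
by rewrite signrN; ring.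
Qed.

Lemma majorana_adj (p : nat) : (p < 2 * N)%N ->
  (majorana C N p) ^t* = majorana C N p.
Proof.
move=> hp; apply/matrixP => a b; rewrite adjmxE !majoranaE.
rewrite -(canF_eq (@flipK N p./2)) eq_sym.
case: eqP => [->|_]; last by rewrite !mul0r rmorph0.
rewrite !mul1r jw_phase_flip // ltnn eqxx /= /jw_phase !rmorphM /= rmorph_sign.
rewrite [jw_sign _ _]/jw_sign rmorph_sign.
case: (odd p); last by rewrite expr0 rmorph1; ring.
by rewrite rmorphM /= conjCi rmorph_sign expr1; ring.
Qed.

(** With [k = N] the string covers every site, so this is Z_1...Z_N, the fermion parity. *)
Definition parity : 'M[C]_(2 ^ N) := diag_mx (\row_b jw_sign N b).

Lemma parity_sqr : parity *m parity = 1%:M.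
Proof.
apply/matrixP => a b; rewrite mul_diag_mx !mxE mulrnAr.
by case: eqP => // ->; rewrite jw_sign_sqr.
Qed.

Lemma parity_majorana (p : nat) : (p < 2 * N)%N ->
  parity *m majorana C N p = - (majorana C N p *m parity).
Proof.
move=> hp; apply/matrixP => a b; rewrite mul_diag_mx [LHS]mxE.
rewrite [RHS]mxE mul_mx_diag [in RHS]mxE !majoranaE !mxE.
case: eqP => [->|_]; last by rewrite !mul0r mulr0 oppr0.
by rewrite jw_sign_flip; [have -> : (p./2 < N)%N by lia|lia]; rewrite expr1; ring.
Qed.

End Majorana.

Lemma adjmxZ (C : numClosedFieldType) m n (a : C) (A : 'M[C]_(m, n)) :
  (a *: A) ^t* = a^* *: A ^t*.
Proof. by apply/matrixP => i j; rewrite !mxE rmorphM. Qed.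

Lemma adjmx_sum (C : numClosedFieldType) m n (I : finType) (F : I -> 'M[C]_(m, n)) :
  (\sum_i F i) ^t* = \sum_i (F i) ^t*.
Proof.
apply/matrixP => i j; rewrite adjmxE !summxE rmorph_sum.
by apply: eq_bigr => k _; rewrite adjmxE.
Qed.

Lemma adjmxM (C : numClosedFieldType) m n p (A : 'M[C]_(m, n)) (B : 'M[C]_(n, p)) :
  (A *m B) ^t* = B ^t* *m A ^t*.
Proof. by rewrite trmx_mul map_mxM. Qed.

(** * Linear combinations of Majorana operators and their commutators with quadratic Hamiltonians *)

Section LinearModes.
Variables (C : numClosedFieldType) (N : nat).
Local Notation c := (majorana C N).
Implicit Types (u v : 'cV[C]_(2 * N)).

Definition mode (v : 'cV[C]_(2 * N)) : 'M[C]_(2 ^ N) := \sum_p v p 0 *: c p.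

Lemma modeZ a v : mode (a *: v) = a *: mode v.
Proof.
by rewrite /mode scaler_sumr; apply: eq_bigr => p _; rewrite mxE scalerA.
Qed.

Lemma majorana_mode_anticomm (p : 'I_(2 * N)) v :
  c p *m mode v + mode v *m c p = (2 * v p 0)%:M.
Proof.
rewrite /mode mulmx_sumr mulmx_suml -big_split /= (bigD1 p) //= big1 ?addr0.
  by rewrite -scalemxAr -scalemxAl -scalerDr majorana_anticomm // eqxx
    scale_scalar_mx mulr1 mulrC.
move=> q /negPf npq; rewrite -scalemxAr -scalemxAl -scalerDr majorana_anticomm //.
by rewrite eq_sym (val_eqE q p) npq mulr0 scale_scalar_mx mulr0 raddf0.
Qed.

Lemma mode_anticomm u v :
  mode u *m mode v + mode v *m mode u = (2 * (u^T *m v) 0 0)%:M.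
Proof.
rewrite {1 4}/mode mulmx_suml mulmx_sumr -big_split /=.
under eq_bigr => p _.
  rewrite -scalemxAl -scalemxAr -scalerDr majorana_mode_anticomm scale_scalar_mx.
  over.
rewrite -raddf_sum /= mxE mulr_sumr; congr (_%:M); apply: eq_bigr => p _.
by rewrite mxE; ring.
Qed.

Lemma mode_adj v : (mode v) ^t* = mode (map_mx Num.conj v).
Proof.
rewrite /mode adjmx_sum; apply: eq_bigr => p _.
by rewrite adjmxZ majorana_adj // mxE.
Qed.

Lemma parity_mode v : parity C N *m mode v = - (mode v *m parity C N).
Proof.
rewrite /mode mulmx_sumr mulmx_suml -sumrN; apply: eq_bigr => p _.
by rewrite -scalemxAr -scalemxAl parity_majorana // scalerN.
Qed.

Lemma parity_hatV (V : 'M[C]_(2 * N)) :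
  parity C N *m hatV V = hatV V *m parity C N.
Proof.
rewrite /hatV -scalemxAr -scalemxAl mulmx_sumr mulmx_suml; congr (_ *: _).
apply: eq_bigr => p _; rewrite mulmx_sumr mulmx_suml; apply: eq_bigr => q _.
rewrite -scalemxAr -scalemxAl mulmxA parity_majorana // mulNmx -[c p *m _ *m c q]mulmxA.
by rewrite parity_majorana // mulmxN opprK mulmxA.
Qed.

(** Anticommuting twice gives [c_p c_q, c(v)] = 2 v_q c_p - 2 v_p c_q. Antisymmetry of [V] makes the
    two resulting sums contribute equally, and their total 4 c(V v) cancels the 1/4 in [hatV]. *)
Lemma hatV_comm_mode (V : 'M[C]_(2 * N)) v : V^T = - V ->
  hatV V *m mode v - mode v *m hatV V = mode ('i *: (V *m v)).
Proof.
move=> VT; have Vpq p q : V p q = - V q p.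
  by have /matrixP/(_ q p) := VT; rewrite !mxE.
have comm2 (p q : 'I_(2 * N)) : c p *m c q *m mode v - mode v *m (c p *m c q)
    = (2 * v q 0) *: c p - (2 * v p 0) *: c q.
  have -> : (2 * v q 0) *: c p = c p *m (c q *m mode v + mode v *m c q).
    by rewrite majorana_mode_anticomm mul_mx_scalar.
  have -> : (2 * v p 0) *: c q = (c p *m mode v + mode v *m c p) *m c q.
    by rewrite majorana_mode_anticomm mul_scalar_mx.
  by rewrite mulmxDl mulmxDr !mulmxA opprD addrA addrK.
rewrite /hatV -scalemxAl -scalemxAr -scalerBr mulmx_suml mulmx_sumr -sumrB.
have -> : \sum_p ((\sum_q V p q *: (c p *m c q)) *m mode v -
     mode v *m (\sum_q V p q *: (c p *m c q))) = 4 *: mode (V *m v).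
  under eq_bigr => p _ do rewrite mulmx_suml mulmx_sumr -sumrB.
  under eq_bigr => p _ do under eq_bigr => q _ do
    rewrite -scalemxAl -scalemxAr -scalerBr comm2 scalerBr !scalerA.
  under eq_bigr => p _ do rewrite sumrB.
  rewrite sumrB [X in _ - X]exchange_big /= -sumrB /mode scaler_sumr.
  apply: eq_bigr => p _; rewrite -!scaler_suml -scalerBl scalerA; congr (_ *: _).
  rewrite mxE -sumrB mulr_sumr; apply: eq_bigr => q _.
  by rewrite (Vpq q p); ring.
by rewrite modeZ scalerA divfK // pnatr_eq0.
Qed.

Lemma hatV_adj (V : 'M[C]_(2 * N)) : real_antisym V -> (hatV V) ^t* = hatV V.
Proof.
move=> [Vreal VT]; have Vpq p q : V p q = - V q p.
  by have /matrixP/(_ q p) := VT; rewrite !mxE.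
rewrite /hatV adjmxZ adjmx_sum.
under eq_bigr => p _.
  rewrite adjmx_sum; under eq_bigr => q _.
    rewrite adjmxZ adjmxM !majorana_adj // (CrealP (Vreal p q)) Vpq scaleNr; over.
  over.
rewrite exchange_big /=; under eq_bigr => p _ do rewrite sumrN.
rewrite sumrN scalerN -scaleNr rmorphM /= conjCi fmorphV /= rmorph_nat.
by rewrite mulNr opprK.
Qed.

End LinearModes.

(** * Diagonalization, joint kernels and squared norms *)

Section SpectralTools.
Variable C : numClosedFieldType.

Lemma conj_unitaryM n (U X Y : 'M[C]_n) : U ^t* *m U = 1%:M ->
  U *m X *m U ^t* *m (U *m Y *m U ^t* ) = U *m (X *m Y) *m U ^t*.
Proof. by move=> UU; rewrite !mulmxA -(mulmxA _ (U ^t* ) U) UU mulmx1. Qed.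

Lemma hermitian_diagonalization n (A : 'M[C]_n) : A ^t* = A ->
  exists (U : 'M[C]_n) (d : 'rV[C]_n),
    [/\ U *m U ^t* = 1%:M, U ^t* *m U = 1%:M, forall i, d 0 i \is Num.real
      & U *m A *m U ^t* = diag_mx d].
Proof.
move=> hA; have herm : A \is hermsymmx.
  by apply/is_hermitianmxP; rewrite expr0 scale1r hA.
have uU := spectral_unitarymx A.
have UU : spectralmx A *m (spectralmx A) ^t* = 1%:M by apply/unitarymxP.
exists (spectralmx A), (spectral_diag A); split => //.
- exact: mulmx1C.
- by move=> i; apply: (mxOverP (hermitian_spectral_diag_real herm)).
- have /hermitian_normalmx/orthomx_spectralP eqA := herm.
  by rewrite [X in _ *m X *m _]eqA invmx_unitary // !mulmxA UU mul1mx -mulmxA UU mulmx1.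
Qed.

Lemma char_poly_conj n (U A W : 'M[C]_n) : U *m W = 1%:M ->
  char_poly (U *m A *m W) = char_poly A.
Proof.
move=> UW; rewrite /char_poly /char_poly_mx.
set f := map_mx polyC.
have fUW : f U *m f W = 1%:M by rewrite -map_mxM UW map_mx1.
have -> : 'X%:M - f (U *m A *m W) = f U *m ('X%:M - f A) *m f W.
  rewrite mulmxBr mulmxBl -[f (_ *m _)]/(map_mx _ _) !map_mxM; congr (_ - _).
  by rewrite mul_mx_scalar -scalemxAl fUW scalemx1.
by rewrite !det_mulmx mulrAC -det_mulmx fUW det1 mul1r.
Qed.

(** The characteristic polynomial fixes the eigenvalues up to a permutation; permuting the rows of a
    diagonalizing unitary then lists them as [E]. *)
Lemma sorted_diagonalization n (A : 'M[C]_n) (E : nat -> C) :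
  A ^t* = A -> sorted_eigenvalues A E ->
  exists U : 'M[C]_n, [/\ U *m U ^t* = 1%:M, U ^t* *m U = 1%:M,
    forall i : 'I_n, E i \is Num.real & U *m A *m U ^t* = diag_mx (\row_i E i)].
Proof.
move=> hA [cpE _]; have [U [d [UU UU' dreal Ud]]] := hermitian_diagonalization hA.
have := char_poly_conj A UU; rewrite Ud cpE char_poly_trig ?diag_mx_is_trig //.
have -> : \prod_(i < n) ('X - ((diag_mx d) i i)%:P)
    = \prod_(x <- [tuple d 0 i | i < n]) ('X - x%:P).
  by rewrite big_tuple; apply: eq_bigr => i _; rewrite tnth_mktuple !mxE eqxx mulr1n.
have -> : \prod_(i < n) ('X - (E i)%:P)
    = \prod_(x <- [tuple E i | i < n]) ('X - x%:P).
  by rewrite big_tuple; apply: eq_bigr => i _; rewrite tnth_mktuple.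
move=> /esym/prod_XsubC_eq/tuple_permP[s sE].
have Es (i : 'I_n) : E i = d 0 (s i).
  have /(congr1 (fun t : n.-tuple C => tnth t i)) := val_inj sE.
  by rewrite !tnth_mktuple.
exists (row_perm s U).
have adjp : (row_perm s U) ^t* = U ^t* *m (perm_mx s) ^t*.
  by rewrite row_permE adjmxM.
have PP : perm_mx s *m (perm_mx s) ^t* = 1%:M :> 'M[C]_n.
  rewrite tr_perm_mx map_perm_mx -perm_mxM; apply/matrixP => i j.
  by rewrite !mxE /= permM permK.
rewrite adjp row_permE; split.
- by rewrite mulmxA -(mulmxA _ U) UU mulmx1.
- by rewrite mulmxA -(mulmxA (U ^t* )) (mulmx1C PP) mulmx1.
- by move=> i; rewrite Es.
- have -> : perm_mx s *m U *m A *m (U ^t* *m perm_mx s ^t* )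
      = perm_mx s *m (U *m A *m U ^t* ) *m perm_mx s ^t* by rewrite !mulmxA.
  rewrite Ud; apply/matrixP => i j.
  rewrite tr_perm_mx map_perm_mx -col_permE -row_permE !mxE Es.
  by rewrite (inj_eq perm_inj).
Qed.

(* The adjoint of the last [B] maps the joint kernel of all the [B]s
   isomorphically onto a complement of it inside the joint kernel of the
   remaining ones, so the dimension doubles each time one [B] is dropped. *)
Lemma joint_kernel_dim n m w (B : nat -> 'M[C]_n) (W : 'M[C]_(w, n)) :
  (forall i j, (i < m)%N -> (j < m)%N ->
     (B i) ^t* *m B j + B j *m (B i) ^t* = (2 * (i == j)%:R)%:M) ->
  (forall i, (i < m)%N -> W *m B i = 0) ->
  row_free W -> (2 ^ m * w <= n)%N.
Proof.
elim: m w W => [|m IH] w W car kill Wfree.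
  by rewrite mul1n -(eqP Wfree) rank_leq_col.
have -> : (2 ^ m.+1 * w = 2 ^ m * (w + w))%N by rewrite expnS; lia.
have Wm : W *m (B m) ^t* *m B m = 2 *: W.
  have /(congr1 (mulmx W)) := car m m (ltnSn m) (ltnSn m).
  by rewrite mulmxDr !mulmxA kill // mul0mx addr0 eqxx mulr1 mul_mx_scalar.
apply: (IH _ (col_mx W (W *m (B m) ^t* ))).
- by move=> i j hi hj; apply: car; apply: ltnW.
- move=> i hi; rewrite mul_col_mx kill 1?ltnW //.
  have /(congr1 (mulmx W)) := car m i (ltnSn m) (ltnW hi).
  rewrite mulmxDr !mulmxA kill 1?ltnW // mul0mx addr0 => ->.
  by rewrite gtn_eqF // mulr0 raddf0 mulmx0 col_mx0.
(* Multiplying a vanishing combination of the two blocks by [B m] kills the first block and turns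
   the second into [2 *: W], so the second coefficient is zero, and then the first. *)
- rewrite -kermx_eq0; apply/eqP; set K := kermx _.
  have := mulmx_ker (col_mx W (W *m (B m) ^t* )); rewrite -/K -[K]hsubmxK mul_row_col => KW.
  have := congr1 (mulmx^~ (B m)) KW.
  rewrite mulmxDl mul0mx -mulmxA kill // mulmx0 add0r -mulmxA Wm -scalemxAr.
  move=> /eqP; rewrite scaler_eq0 pnatr_eq0 /= mulmx_free_eq0 // => /eqP r0.
  move/eqP: KW; rewrite r0 mul0mx addr0 mulmx_free_eq0 // => /eqP ->.
  by rewrite row_mx0.
Qed.

Definition nsq n (x : 'cV[C]_n) : C := \sum_i `|x i 0| ^+ 2.

Lemma nsqE n (x : 'cV[C]_n) : nsq x = (x ^t* *m x) 0 0.
Proof. by rewrite mxE; apply: eq_bigr => i _; rewrite adjmxE normCKC. Qed.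

Lemma nsq_ge0 n (x : 'cV[C]_n) : 0 <= nsq x.
Proof. by apply: sumr_ge0 => i _; rewrite exprn_ge0. Qed.

Lemma nsq_eq0 n (x : 'cV[C]_n) : (nsq x == 0) = (x == 0).
Proof.
apply/idP/eqP => [|->]; last by rewrite /nsq big1 // => i _; rewrite mxE normr0 expr0n.
rewrite psumr_eq0 => [/allP h|i _]; last by rewrite exprn_ge0.
apply/colP => i; have := h i (mem_index_enum i).
by rewrite expf_eq0 /= normr_eq0 mxE => /eqP.
Qed.

Lemma nsq_unitary n (U : 'M[C]_n) (x : 'cV[C]_n) :
  U ^t* *m U = 1%:M -> nsq (U *m x) = nsq x.
Proof. by move=> UU; rewrite !nsqE adjmxM mulmxA -(mulmxA _ _ U) UU mulmx1. Qed.

Lemma nsqZ n a (x : 'cV[C]_n) : nsq (a *: x) = `|a| ^+ 2 * nsq x.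
Proof.
by rewrite /nsq mulr_sumr; apply: eq_bigr => i _; rewrite mxE normrM exprMn.
Qed.

Lemma opnorm_le_nsq n (A : 'M[C]_n) (e : C) (x : 'cV[C]_n) :
  0 <= e -> opnorm_le A e -> nsq (A *m x) <= e ^+ 2 * nsq x.
Proof.
move=> e0 /(_ x); rewrite /vnorm -/(nsq (A *m x)) -/(nsq x) => h.
rewrite -[nsq (A *m x)]sqrtCK -[nsq x in X in _ <= X]sqrtCK -exprMn.
by rewrite lerXn2r // nnegrE ?mulr_ge0 ?sqrtC_ge0 ?nsq_ge0.
Qed.

Lemma exists_kernel_vector k s (Q : 'M[C]_(s, k)) : (s < k)%N ->
  exists2 y : 'cV[C]_k, y != 0 & Q *m y = 0.
Proof.
move=> sk; have : cokermx Q != 0.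
  rewrite cokermx_eq0 /row_full; apply/eqP => h.
  by have := rank_leq_row Q; rewrite h leqNgt sk.
move=> cn0; have [j] : exists j, col j (cokermx Q) != 0.
  apply/existsP; apply: contraR cn0; rewrite negb_exists => /forallP h.
  apply/eqP/matrixP => i j; have := h j; rewrite negbK => /eqP/colP/(_ i).
  by rewrite !mxE.
by exists (col j (cokermx Q)) => //; rewrite colE mulmxA mulmx_coker mul0mx.
Qed.

(* A nonzero [z = X *m y] orthogonal to all eigenvectors with eigenvalue at
   least [1 - e] would have |M z - z| > e |z|. *)
Lemma eigenvectors_near_one n k (M : 'M[C]_n) (X : 'M[C]_(n, k)) (e : C) :
  0 <= e -> M ^t* = M ->
  (forall y : 'cV[C]_k, X *m y = 0 -> y = 0) ->
  (forall y : 'cV[C]_k, nsq (M *m (X *m y) - X *m y) <= e ^+ 2 * nsq (X *m y)) ->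
  exists (u : 'I_k -> 'cV[C]_n) (lam : 'I_k -> C),
    [/\ forall i j, ((u i) ^t* *m u j) 0 0 = (i == j)%:R,
        forall i, M *m u i = lam i *: u i & forall i, 1 - e <= lam i].
Proof.
move=> e0 hM Xinj near1.
have [U [d [UU UU' dreal Ud]]] := hermitian_diagonalization hM.
have MU : M *m U ^t* = U ^t* *m diag_mx d by rewrite -Ud !mulmxA UU' mul1mx.
have UM : U *m M = diag_mx d *m U by rewrite -Ud -mulmxA UU' mulmx1.
pose S := [set j : 'I_n | 1 - e <= d 0 j].
have kS : (k <= #|S|)%N.
  rewrite leqNgt; apply/negP => Sk.
  (* The coordinates of [U *m X *m y] indexed by [S] impose fewer than [k] linear conditions, so
     some nonzero [y] makes them all vanish. *)
  have [y y0 Qy] := exists_kernel_vector (rowsub (@enum_val _ (mem S)) (U *m X)) Sk.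
  pose w := U *m (X *m y).
  have wS j : j \in S -> w j 0 = 0.
    move=> jS; have /colP/(_ (enum_rank_in jS j)) := Qy.
    rewrite [in X in _ = X -> _]mxE => <-; rewrite /w mulmxA [LHS]mxE [RHS]mxE.
    by apply: eq_bigr => a _; rewrite [rowsub _ _ _ _]mxE enum_rankK_in.
  have := near1 y; rewrite -(nsq_unitary _ UU') -[nsq (X *m y)](nsq_unitary _ UU').
  rewrite mulmxBr (mulmxA U M) UM -(mulmxA _ U) -/w => hle.
  have termE j : `|(diag_mx d *m w - w) j 0| ^+ 2 - e ^+ 2 * `|w j 0| ^+ 2
      = ((1 - d 0 j) ^+ 2 - e ^+ 2) * `|w j 0| ^+ 2.
    have -> : (diag_mx d *m w - w) j 0 = - ((1 - d 0 j) * w j 0).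
      by rewrite [LHS]mxE mul_diag_mx [in LHS]mxE [(- w) j 0]mxE; ring.
    by rewrite normrN normrM exprMn mulrBl real_normK ?realB ?real1.
  have posd j : j \notin S -> 0 < (1 - d 0 j) ^+ 2 - e ^+ 2.
    rewrite inE -real_ltNge ?realB ?real1 ?(ger0_real e0) ?dreal // => hj.
    have he : e < 1 - d 0 j by rewrite ltrBrDr addrC -ltrBrDr.
    by rewrite subr_gt0 ltrXn2r // ?nnegrE ?(ltW (le_lt_trans e0 he)).
  have term_ge0 j : 0 <= ((1 - d 0 j) ^+ 2 - e ^+ 2) * `|w j 0| ^+ 2.
    have [jS|jS] := boolP (j \in S); first by rewrite wS // normr0 expr0n mulr0.
    by rewrite mulr_ge0 ?exprn_ge0 // ltW ?posd.
  have sum0 : \sum_j ((1 - d 0 j) ^+ 2 - e ^+ 2) * `|w j 0| ^+ 2 = 0.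
    apply/eqP; rewrite eq_le sumr_ge0 ?andbT; last by move=> j _; apply: term_ge0.
    under eq_bigr => j _ do rewrite -termE.
    by rewrite sumrB -mulr_sumr subr_le0.
  have w0 : w = 0.
    apply/colP => j; rewrite [RHS]mxE; have [jS|jS] := boolP (j \in S); first exact: wS.
    have : ((1 - d 0 j) ^+ 2 - e ^+ 2) * `|w j 0| ^+ 2 = 0.
      by apply: (psumr_eq0P _ sum0) => // i _; apply: term_ge0.
    by move/eqP; rewrite mulf_eq0 (gt_eqF (posd j jS)) /= expf_eq0 /= normr_eq0 => /eqP.
  have : X *m y = 0 by rewrite -[LHS]mul1mx -UU' -mulmxA -/w w0 mulmx0.
  by move/Xinj/eqP; apply/negP.
pose f (i : 'I_k) := enum_val (widen_ord kS i).
exists (fun i => col (f i) (U ^t* )), (fun i => d 0 (f i)); split.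
- move=> i j; have -> : (col (f i) (U ^t* )) ^t* = row (f i) U.
    by apply/matrixP => a b; rewrite !mxE conjCK.
  have -> : (row (f i) U *m col (f j) (U ^t* )) 0 0 = (U *m U ^t* ) (f i) (f j).
    by rewrite !mxE; apply: eq_bigr => a _; rewrite !mxE.
  rewrite UU mxE (inj_eq enum_val_inj); congr (_%:R).
- move=> i; rewrite {1}colE mulmxA MU -colE; apply/colP => a.
  by rewrite mul_mx_diag !mxE mulrC.
- by move=> i; have := enum_valP (widen_ord kS i); rewrite inE.
Qed.

End SpectralTools.

(** * The unperturbed chain matrix *)

Section Chain.
Variables (C : numClosedFieldType) (N : nat).

(* Out-of-range indices read as [0]. *)
Definition entry n (x : 'cV[C]_n) (k : nat) : C :=
  if insub k is Some i then x i 0 else 0.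

Lemma entryE n (x : 'cV[C]_n) (i : 'I_n) : entry x i = x i 0.
Proof. by rewrite /entry valK. Qed.

Lemma entry_out n (x : 'cV[C]_n) k : (n <= k)%N -> entry x k = 0.
Proof. by move=> nk; rewrite /entry insubN // -leqNgt. Qed.

Lemma sum_entry n (x : 'cV[C]_n) (k : nat) :
  \sum_(i < n) (k == i :> nat)%:R * x i 0 = entry x k.
Proof.
case: (ltnP k n) => [kn|nk].
  rewrite (bigD1 (Ordinal kn)) //= eqxx mul1r big1 ?addr0 -?(entryE x (Ordinal kn)) //.
  by move=> i; rewrite -val_eqE /= eq_sym => /negPf ->; rewrite mul0r.
rewrite entry_out // big1 // => i _.
by rewrite gtn_eqF ?mul0r // (leq_trans _ nk).
Qed.

(** In 0-based indices the bonds join an odd [p] to [p.+1]. The indices 0 and 2N-1 lie on no bond: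
    they are the free Majorana operators at the ends. *)
Definition chain : 'M[C]_(2 * N) :=
  \matrix_(p, q) ((odd p && (p.+1 == q :> nat))%:R - (odd q && (q.+1 == p :> nat))%:R).

Lemma chain_tr : chain^T = - chain.
Proof. by apply/matrixP => p q; rewrite !mxE opprB. Qed.

Lemma chain_real p q : chain p q \is Num.real.
Proof. by rewrite mxE realB ?realn. Qed.

(** Each bond occurs twice in the double sum, with opposite coefficients and opposite operator
    order; anticommutation makes the two terms equal, which turns 1/4 into 1/2. *)
Lemma H0_hatV : H0 C N = hatV chain.
Proof.
rewrite /H0 /hatV.
have chainE (p q : 'I_(2 * N)) : chain p q =
    \sum_(j < N.-1) (((p == 2 * j + 1 :> nat)%N && (q == 2 * j + 2 :> nat)%N)%:R
      - ((p == 2 * j + 2 :> nat)%N && (q == 2 * j + 1 :> nat)%N)%:R).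
  have key (a b : 'I_(2 * N)) : (odd a && (a.+1 == b :> nat))%:R =
     \sum_(j < N.-1) ((a == 2 * j + 1 :> nat)%N && (b == 2 * j + 2 :> nat)%N)%:R :> C.
    case: (boolP (odd a && (a.+1 == b :> nat))) => [/andP[oa /eqP ab]|hab].
      have ha : (a./2 < N.-1)%N by have := ltn_ord b; lia.
      rewrite (bigD1 (Ordinal ha)) //= big1 ?addr0.
        by have -> : (nat_of_ord a == 2 * a./2 + 1)%N && (nat_of_ord b == 2 * a./2 + 2)%N by lia.
      move=> j; rewrite -val_eqE /= => hj.
      by have -> : (nat_of_ord a == 2 * j + 1)%N && (nat_of_ord b == 2 * j + 2)%N = false by lia.
    rewrite big1 // => j _.
    by have -> : (nat_of_ord a == 2 * j + 1)%N && (nat_of_ord b == 2 * j + 2)%N = false by lia.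
  by rewrite mxE !key -sumrB; apply: eq_bigr => j _; rewrite [X in _ - (nat_of_bool X)%:R]andbC.
have pick (f : nat -> nat -> 'M[C]_(2 ^ N)) (a b : nat) : (a < 2 * N)%N -> (b < 2 * N)%N ->
    \sum_(p < 2 * N) \sum_(q < 2 * N) ((p == a :> nat) && (q == b :> nat))%:R *: f p q
    = f a b.
  move=> ha hb; rewrite (bigD1 (Ordinal ha)) //= [X in _ + X]big1 ?addr0.
    rewrite (bigD1 (Ordinal hb)) //= !eqxx scale1r big1 ?addr0 //.
    by move=> q; rewrite -val_eqE /= => /negPf ->; rewrite scale0r.
  move=> p; rewrite -val_eqE /= => /negPf ->.
  by rewrite big1 // => q _; rewrite scale0r.
have -> : \sum_(p < 2 * N) \sum_(q < 2 * N)
       chain p q *: (majorana C N p *m majorana C N q)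
  = \sum_(j < N.-1) 2 *: (majorana C N (2 * j + 1) *m majorana C N (2 * j + 2)).
  under eq_bigr => p _ do under eq_bigr => q _ do rewrite chainE scaler_suml.
  under eq_bigr => p _ do rewrite exchange_big.
  rewrite exchange_big /=; apply: eq_bigr => j _.
  under eq_bigr => p _ do under eq_bigr => q _ do rewrite scalerBl.
  under eq_bigr => p _ do rewrite sumrB.
  have hj := ltn_ord j.
  rewrite sumrB !(pick (fun p q => majorana C N p *m majorana C N q)); try lia.
  have /eqP := @majorana_anticomm C N (2 * j + 1) (2 * j + 2) ltac:(lia) ltac:(lia).
  have -> : (2 * j + 1 == 2 * j + 2)%N = false by lia.
  by rewrite mulr0 raddf0 addrC addr_eq0 => /eqP ->; rewrite opprK scaler_nat mulr2n.
rewrite -scaler_sumr scalerA; congr (_ *: _).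
by field.
Qed.

Lemma chain_mulE (x : 'cV[C]_(2 * N)) k : entry (chain *m x) k =
  if (k < 2 * N)%N then
    if odd k then entry x k.+1 else if k == 0%N then 0 else - entry x k.-1
  else 0.
Proof.
case: ltnP => hk; last exact: entry_out.
rewrite (entryE _ (Ordinal hk)) mxE.
under eq_bigr => q _ do rewrite mxE mulrBl /=.
rewrite sumrB; case ok: (odd k) => /=.
  rewrite sum_entry big1 ?subr0 // => q _.
  have -> : odd q && (q.+1 == k)%N = false by lia.
  by rewrite mul0r.
rewrite big1 ?sub0r; last by move=> q _; rewrite mul0r.
case: eqP => [->|k0]; first by rewrite big1 ?oppr0 // => q _; rewrite andbF mul0r.
congr (- _); rewrite -sum_entry; apply: eq_bigr => q _.
by congr (_%:R * _); lia.
Qed.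

Lemma chain_sqrE (x : 'cV[C]_(2 * N)) k : entry (chain *m (chain *m x)) k =
  if (0 < k < (2 * N).-1)%N then - entry x k else 0.
Proof.
rewrite chain_mulE; case: ltnP => hk; last first.
  by have -> : (0 < k < (2 * N).-1)%N = false by lia.
rewrite !chain_mulE; case: ifP => ok.
  case: ltnP => hk1; last by have -> : (0 < k < (2 * N).-1)%N = false by lia.
  have -> : odd k.+1 = false by lia.
  have -> : (0 < k < (2 * N).-1)%N by lia.
  by rewrite /=.
case: eqP => k0; first by rewrite k0.
have -> : (k.-1 < 2 * N)%N by lia.
have -> : odd k.-1 by lia.
have -> : (0 < k < (2 * N).-1)%N by lia.
by rewrite prednK //; lia.
Qed.

(** By antisymmetry the left side is minus the quadratic form of the square of [chain], and minus
    that square is the projection deleting the coordinates 0 and 2N-1. *)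
Lemma nsq_chain (x : 'cV[C]_(2 * N)) : nsq (chain *m x) <= nsq x.
Proof.
have -> : nsq (chain *m x) = - (x ^t* *m (chain *m (chain *m x))) 0 0.
  rewrite nsqE adjmxM; have -> : chain ^t* = - chain.
    rewrite chain_tr; apply/matrixP => p q; rewrite !mxE rmorphN rmorphB /=.
    by rewrite !rmorph_nat.
  by rewrite mulmxN mulNmx !mulmxA !mxE.
rewrite mxE -sumrN; apply: ler_sum => k _.
rewrite adjmxE -[(chain *m _) k 0]entryE chain_sqrE entryE; case: ifP => _.
  by rewrite mulrN opprK -normCKC.
by rewrite mulr0 oppr0 exprn_ge0.
Qed.

(** * An approximate zero mode of the perturbed chain, grown from its left end *)

Section ZeroMode.
Variables (V : 'M[C]_(2 * N)) (r : nat) (eps : C).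
Hypotheses (Vas : real_antisym V) (Vnorm : opnorm_le V eps) (Vrange : has_range V r).
Hypotheses (N2 : (2 <= N)%N) (eps0 : 0 <= eps).

(** The word V (A0 V)^m; applied to e_0 it is the residual left by the truncated series
    [zero_mode m], as long as the range of [V] does not connect the ends. *)
Fixpoint walk (m : nat) : 'M[C]_(2 * N) :=
  if m is m'.+1 then V *m chain *m walk m' else V.

Lemma walkSr m : walk m.+1 = walk m *m chain *m V.
Proof.
elim: m => [//|m IH].
rewrite -[LHS]/(V *m chain *m walk m.+1) [in LHS]IH -[walk m.+1]/(V *m chain *m walk m).
by rewrite !mulmxA.
Qed.

(** The word is a palindrome of [2m+1] antisymmetric factors: transposition reverses it onto itself
    with an odd number of signs. *)
Lemma walk_tr m : (walk m)^T = - walk m.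
Proof.
have VT : V^T = - V by case: Vas.
elim: m => [//|m IH]; rewrite [in LHS]walkSr 2!trmx_mul IH chain_tr VT.
by rewrite !(mulNmx, mulmxN) !opprK /= mulmxA.
Qed.

Lemma walk_real m p q : walk m p q \is Num.real.
Proof.
have Vreal : forall p q, V p q \is Num.real by case: Vas.
elim: m p q => [//|m IH] p q.
rewrite mxE rpred_sum // => s _; rewrite rpredM // mxE rpred_sum // => t _.
by rewrite rpredM // chain_real.
Qed.

Lemma walk_diag m p : walk m p p = 0.
Proof.
have /matrixP/(_ p p) := walk_tr m; rewrite !mxE => /eqP.
by rewrite -addr_eq0 -mulr2n mulrn_eq0 /= => /eqP.
Qed.

(** The [m.+1] factors [V] each shift the index by at most [r], and the [m] factors [chain] by one:
    [r + m * r.+1] in all. *)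
Lemma walk_range m (p q : 'I_(2 * N)) :
  (q + r + m * r.+1 < p)%N -> walk m p q = 0.
Proof.
elim: m p => [|m IH] p h; first by apply: Vrange; rewrite mul0n addn0 in h; rewrite h orbT.
have h' : (q + r + (r.+1 + m * r.+1) < p)%N by rewrite -mulSn.
rewrite mxE big1 // => s _.
case: (ltnP (q + r + m * r.+1)%N s) => hs; first by rewrite IH ?mulr0.
rewrite mxE big1 ?mul0r // => t _; rewrite mxE.
case: (ltnP (t + r)%N p) => ht; first by rewrite Vrange ?ht ?orbT // mul0r.
have -> : odd t && (t.+1 == s)%N = false by lia.
have -> : odd s && (s.+1 == t)%N = false by lia.
by rewrite subrr mulr0.
Qed.

Let n_gt0 : (0 < 2 * N)%N. Proof. by rewrite muln_gt0 (ltnW N2). Qed.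
Let i0 : 'I_(2 * N) := Ordinal n_gt0.

Local Notation e0 := (delta_mx i0 0 : 'cV[C]_(2 * N)).

Fixpoint zero_mode (m : nat) : 'cV[C]_(2 * N) :=
  if m is m'.+1 then zero_mode m' + chain *m (walk m' *m e0)
  else e0.

Lemma walk_deltaE m p : (walk m *m e0) p 0 = walk m p i0 :> C.
Proof. by rewrite -colE mxE. Qed.

Lemma zero_mode_residual m : (m * r.+1 < 2 * N)%N ->
  (chain + V) *m zero_mode m = walk m *m e0.
Proof.
elim: m => [|m IH] hm /=.
  rewrite mulmxDl; suff -> : chain *m e0 = 0 by rewrite add0r.
  apply/colP => p; rewrite -colE !mxE /=.
  have -> : odd p && (p.+1 == 0)%N = false by lia.
  by rewrite subr0.
have hm' : (r.+1 + m * r.+1 < 2 * N)%N by rewrite -mulSn.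
rewrite mulmxDr IH; last by lia.
rewrite mulmxDl.
(* The new term cancels the old residual, since [chain] squares to -1 away from the ends. At index 0
   the residual vanishes by antisymmetry of [walk]; at 2N-1 by its range, which needs
   [r + m * r.+1 < 2N - 1], exactly the hypothesis for [m.+1]. *)
have -> : chain *m (chain *m (walk m *m e0)) = - (walk m *m e0).
  apply/colP => p; rewrite -entryE chain_sqrE entryE [RHS]mxE.
  case: ifP => // /negP hp; rewrite walk_deltaE.
  have [p0|p0] := posnP p.
    have -> : p = i0 by apply: val_inj.
    by rewrite walk_diag oppr0.
  by rewrite walk_range ?oppr0 //=; have := ltn_ord p; lia.
by rewrite addrA subrr add0r !mulmxA.
Qed.

Lemma zero_mode_real m p : zero_mode m p 0 \is Num.real.
Proof.
elim: m => [|m IH] /=; first by rewrite mxE realn.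
rewrite mxE rpredD // mxE rpred_sum // => q _.
by rewrite rpredM ?chain_real // walk_deltaE walk_real.
Qed.

(** Row 0 of [chain] is zero, so the corrections never touch coordinate 0, which keeps its value
    1. *)
Lemma nsq_zero_mode_ge1 m : 1 <= nsq (zero_mode m).
Proof.
have -> : 1 = `|zero_mode m i0 0| ^+ 2.
  elim: m => [|m IH] /=; first by rewrite mxE !eqxx normr1 expr1n.
  by rewrite mxE -[(chain *m _) i0 0]entryE chain_mulE /= n_gt0 addr0.
by rewrite /nsq (bigD1 i0) //= lerDl sumr_ge0 // => i _; rewrite exprn_ge0.
Qed.

Lemma nsq_walk m : nsq (walk m *m e0) <= (eps ^+ 2) ^+ m.+1.
Proof.
have Vle x : nsq (V *m x) <= eps ^+ 2 * nsq x by apply: opnorm_le_nsq.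
have e20 : 0 <= eps ^+ 2 by rewrite exprn_ge0.
elim: m => [|m IH].
  apply: le_trans (Vle _) _; rewrite expr1 -[X in _ <= X]mulr1 ler_wpM2l //.
  rewrite /nsq (bigD1 i0) //= big1 ?addr0; first by rewrite mxE !eqxx normr1 expr1n.
  by move=> i /negPf hi; rewrite mxE hi normr0 expr0n.
rewrite /= -!mulmxA; apply: le_trans (Vle _) _.
rewrite exprS ler_wpM2l //; exact: le_trans (nsq_chain _) IH.
Qed.

Lemma zero_mode_small m : (m * r.+1 < 2 * N)%N ->
  nsq ((chain + V) *m zero_mode m) <= (eps ^+ 2) ^+ m.+1 * nsq (zero_mode m).
Proof.
move=> hm; rewrite zero_mode_residual //; apply: le_trans (nsq_walk m) _.
by rewrite ler_peMr ?exprn_ge0 ?nsq_zero_mode_ge1.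
Qed.

End ZeroMode.

(** Column [j] is ['i] e_(2j+1) + e_(2j+2), an unnormalized eigenvector of ['i *: chain] for the
    eigenvalue 1. Without the test [p != 0], the truncated predecessor would also put index 0 in
    column 0. *)
Definition positive_modes : 'M[C]_(2 * N, N.-1) :=
  \matrix_(p, j) (if odd p then 'i * (p./2 == j :> nat)%:R
                  else ((p != 0%N :> nat) && (p./2.-1 == j :> nat))%:R).

Lemma positive_modesE (y : 'cV[C]_N.-1) k : entry (positive_modes *m y) k =
  if odd k then 'i * entry y k./2
  else if k == 0%N then 0 else entry y k./2.-1.
Proof.
case: (ltnP k (2 * N)) => hk; last first.
  rewrite entry_out //; case: ifP => ok; first by rewrite entry_out ?mulr0 //; lia.
  by case: eqP => // k0; rewrite entry_out //; lia.
rewrite (entryE _ (Ordinal hk)) mxE.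
case: ifP => ok.
  rewrite -sum_entry mulr_sumr; apply: eq_bigr => j _.
  by rewrite mxE /= ok mulrA.
case: eqP => k0.
  by rewrite big1 // => j _; rewrite mxE /= ok k0 mul0r.
by rewrite -sum_entry; apply: eq_bigr => j _; rewrite mxE /= ok (introF eqP k0).
Qed.

Lemma chain_positive_modes (y : 'cV[C]_N.-1) :
  'i *: (chain *m (positive_modes *m y)) = positive_modes *m y.
Proof.
apply/colP => p; rewrite mxE -!entryE chain_mulE ltn_ord !positive_modesE.
case: ifP => op.
  have -> : odd p.+1 = false by lia.
  by have -> : (p.+1./2.-1 = p./2)%N by lia.
case: eqP => p0; first by rewrite mulr0.
have -> : odd p.-1 by lia.
have -> : (p.-1./2 = p./2.-1)%N by lia.
by rewrite mulrN mulrA -expr2 sqrCi mulN1r opprK.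
Qed.

Lemma positive_modes_inj (y : 'cV[C]_N.-1) : positive_modes *m y = 0 -> y = 0.
Proof.
move=> h; apply/colP => j; rewrite -entryE [RHS]mxE.
have := positive_modesE y j.*2.+2; rewrite h.
have -> : odd j.*2.+2 = false by lia.
have -> : (j.*2.+2./2.-1 = j)%N by lia.
move=> /= <-; rewrite /entry; case: insubP => // i _ _; by rewrite mxE.
Qed.

End Chain.

(* [P] fixes the nondegenerate eigenvector [i0] up to a phase and anticommutes
   with [b], so [b i0 i0 = 0] and the column [i0] of the commutator bounds the gap. *)
Lemma commutator_gap (C : numClosedFieldType) n (E : 'I_n -> C) (b P : 'M[C]_n)
    (i0 : 'I_n) (g alpha beta : C) :
  let H := diag_mx (\row_i E i) in
  0 < g -> (forall j, j != i0 -> g <= E j - E i0) ->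
  P *m P = 1%:M -> P *m H = H *m P -> P *m b = - (b *m P) ->
  b ^t* *m b = alpha%:M ->
  (H *m b - b *m H) ^t* *m (H *m b - b *m H) = beta%:M ->
  g ^+ 2 * alpha <= beta.
Proof.
move=> H g0 gap PP PH Pb bb hh.
(* Commuting with the diagonal [H], [P] connects only equal energies; as the level [i0] is isolated,
   row and column [i0] of [P] vanish off the diagonal. *)
have Pij i j : (E j - E i) * P i j = 0.
  have /matrixP/(_ i j) := PH; rewrite mul_mx_diag mul_diag_mx !mxE => h.
  by rewrite mulrBl mulrC h subrr.
have gapN j : j != i0 -> E j - E i0 != 0.
  by move=> hj; rewrite gt_eqF // (lt_le_trans g0) ?gap.
have Pl j : j != i0 -> P i0 j = 0.
  by move=> hj; have /eqP := Pij i0 j; rewrite mulf_eq0 (negPf (gapN j hj)) => /eqP.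
have Pr j : j != i0 -> P j i0 = 0.
  move=> hj; have /eqP := Pij j i0; rewrite mulf_eq0 -opprB oppr_eq0.
  by rewrite (negPf (gapN j hj)) => /eqP.
have P0 : P i0 i0 != 0.
  have /matrixP/(_ i0 i0) := PP; rewrite !mxE eqxx (bigD1 i0) //= big1 ?addr0.
    by move=> h; apply/eqP => p0; move/eqP: h; rewrite p0 mul0r eq_sym oner_eq0.
  by move=> j hj; rewrite Pl // mul0r.
have b0 : b i0 i0 = 0.
  have /matrixP/(_ i0 i0) := Pb; rewrite !mxE (bigD1 i0) //= big1 ?addr0; last first.
    by move=> j hj; rewrite Pl // mul0r.
  rewrite (bigD1 i0) //= big1 ?addr0; last by move=> j hj; rewrite Pr // mulr0.
  move=> /eqP; rewrite -addr_eq0 [b _ _ * _]mulrC -mulr2n mulrn_eq0 /= mulf_eq0.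
  by rewrite (negPf P0) => /eqP.
(* The diagonal entry [i0] turns [alpha] into the squared norm of column [i0] of [b], and likewise
   [beta] for the commutator, whose entries are those of [b] weighted by energy differences. *)
have -> : alpha = \sum_j `|b j i0| ^+ 2.
  have /matrixP/(_ i0 i0) := bb; rewrite [X in _ = X]mxE eqxx mulr1n => <-.
  by rewrite mxE; apply: eq_bigr => j _; rewrite adjmxE normCKC.
have -> : beta = \sum_j `|(E j - E i0) * b j i0| ^+ 2.
  have /matrixP/(_ i0 i0) := hh; rewrite [X in _ = X]mxE eqxx mulr1n => <-.
  rewrite mxE; apply: eq_bigr => j _; rewrite adjmxE normCKC.
  have -> // : (H *m b - b *m H) j i0 = (E j - E i0) * b j i0.
  by rewrite mxE mul_diag_mx [X in _ + X]mxE mul_mx_diag !mxE; ring.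
rewrite mulr_sumr; apply: ler_sum => j _.
have [->|hj] := eqVneq j i0; first by rewrite b0 mulr0 normr0 expr0n mulr0.
rewrite normrM exprMn ler_wpM2r ?exprn_ge0 //.
have ge0 : 0 <= E j - E i0 := le_trans (ltW g0) (gap j hj).
by rewrite ger0_norm // lerXn2r ?nnegrE ?gap // ltW.
Qed.

(** * Bounds on the two spectral gaps *)

Section Gaps.
Variables (C : numClosedFieldType) (N : nat).
Implicit Types (V A : 'M[C]_(2 * N)).

Lemma hatV_add A B : hatV (A + B) = hatV A + hatV B :> 'M[C]_(2 ^ N).
Proof.
rewrite /hatV -scalerDr -big_split; congr (_ *: _); apply: eq_bigr => p _.
by rewrite -big_split; apply: eq_bigr => q _; rewrite mxE scalerDl.
Qed.

Lemma Ham_hatV V : Ham V = hatV (chain C N + V).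
Proof. by rewrite /Ham H0_hatV hatV_add. Qed.

Lemma chain_add_antisym V : real_antisym V -> real_antisym (chain C N + V).
Proof.
move=> [Vr VT]; split=> [p q|]; first by rewrite mxE realD ?chain_real.
by rewrite linearD /= chain_tr VT opprD.
Qed.

Lemma antisym_herm A : real_antisym A -> ('i *: A) ^t* = 'i *: A.
Proof.
move=> [Areal AT]; rewrite adjmxZ conjCi AT; apply/matrixP => p q; rewrite !mxE.
by rewrite rmorphN /= (CrealP (Areal p q)) mulrNN.
Qed.

Lemma mode_real_adj (v : 'cV[C]_(2 * N)) : (forall p, v p 0 \is Num.real) ->
  (mode v) ^t* = mode v.
Proof.
move=> vr; rewrite mode_adj; congr mode; apply/colP => p; rewrite mxE.
exact/CrealP.
Qed.

Lemma mode_real_sqr (v : 'cV[C]_(2 * N)) : (forall p, v p 0 \is Num.real) ->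
  mode v *m mode v = (nsq v)%:M.
Proof.
move=> vr; have := mode_anticomm v v; rewrite -mulr2n -scaler_nat.
have -> : (v^T *m v) 0 0 = nsq v.
  rewrite mxE; apply: eq_bigr => p _.
  by rewrite mxE -expr2 real_normK.
rewrite -scale_scalar_mx => h; apply: (scalerI _ h).
by rewrite pnatr_eq0.
Qed.

Lemma first_gap_le A (v : 'cV[C]_(2 * N)) (E : nat -> C) (delta : C) :
  (1 <= N)%N -> real_antisym A -> sorted_eigenvalues (hatV A) E ->
  0 <= delta -> (forall p, v p 0 \is Num.real) -> v != 0 ->
  nsq (A *m v) <= delta ^+ 2 * nsq v -> E 1%N - E 0%N <= delta.
Proof.
move=> N1 Aas hE delta0 vr v0 hAv.
have n2 : (1 < 2 ^ N)%N by rewrite -[X in (X < _)%N](expn0 2) ltn_exp2l.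
have [U [UU UU' Er Ud]] := sorted_diagonalization (hatV_adj Aas) hE.
have [_ Emono] := hE.
have : E 0%N <= E 1%N by apply: Emono.
rewrite le_eqVlt => /predU1P[->|E01]; first by rewrite subrr.
pose cj (X : 'M[C]_(2 ^ N)) := U *m X *m U ^t*.
have cjM X Y : cj X *m cj Y = cj (X *m Y) by apply: conj_unitaryM.
have cjadj X : (cj X) ^t* = cj (X ^t* ) by rewrite /cj !adjmxM trmxCK mulmxA.
have cjB X Y : cj X - cj Y = cj (X - Y) by rewrite /cj mulmxBr mulmxBl.
have cjc a : cj a%:M = a%:M by rewrite /cj mul_mx_scalar -scalemxAl UU scalemx1.
have Avr p : (A *m v) p 0 \is Num.real.
  rewrite mxE rpred_sum // => q _; rewrite rpredM //; by case: Aas.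
have g0 : 0 < E 1%N - E 0%N by rewrite subr_gt0.
have gapj (j : 'I_(2 ^ N)) : j != Ordinal (ltnW n2) -> E 1%N - E 0%N <= E j - E 0%N.
  move=> hj; rewrite lerB //; apply: Emono => //.
  by rewrite lt0n; apply: contra hj => /eqP j0; apply/eqP/val_inj.
have := @commutator_gap C _ (fun j => E j) (cj (mode v)) (cj (parity C N))
  (Ordinal (ltnW n2)) _ (nsq v) (nsq (A *m v)) g0 gapj.
rewrite -Ud -/(cj (hatV A)) !cjM cjadj !cjM cjB cjadj cjM => key.
have {key}key : (E 1%N - E 0%N) ^+ 2 * nsq v <= nsq (A *m v).
  apply: key.
  - by rewrite parity_sqr cjc.
  - by rewrite parity_hatV.
  - by rewrite parity_mode /cj mulmxN mulNmx.
  - by rewrite mode_real_adj // mode_real_sqr // cjc.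
  (* The commutator is ['i] times the mode of the real vector [A *m v]; the phase has modulus one
     and drops out, leaving [nsq (A *m v)]. *)
  - have AT : A^T = - A by case: Aas.
    rewrite hatV_comm_mode // modeZ adjmxZ mode_real_adj // -scalemxAl -scalemxAr.
    rewrite mode_real_sqr // scalerA mulrC -normCK normCi expr1n scale1r.
    by rewrite cjc.
have v_gt0 : 0 < nsq v by rewrite lt_neqAle eq_sym nsq_eq0 v0 nsq_ge0.
have := le_trans key hAv.
by rewrite ler_pM2r // ler_pXn2r // nnegrE ?(ltW g0).
Qed.

Lemma second_gap_ge V (eps : C) (E : nat -> C) :
  (2 <= N)%N -> real_antisym V -> 0 <= eps -> opnorm_le V eps ->
  sorted_eigenvalues (Ham V) E -> 1 - eps <= E 2%N - E 0%N.
Proof.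
move=> N2 Vas eps0 Vnorm; rewrite Ham_hatV => hE.
set A := chain C N + V in hE *; have Aas := chain_add_antisym Vas.
have n3 : (3 <= 2 ^ N)%N by apply: (@leq_trans (2 ^ 2)) => //; rewrite leq_exp2l.
have [U [UU UU' Er Ud]] := sorted_diagonalization (hatV_adj Aas) hE.
have [_ Emono] := hE.
have [Areal AT] := Aas.
have iA_herm := antisym_herm Aas.
have [y|u [lam [u_on u_eig lam_ge]]] := eigenvectors_near_one eps0 iA_herm
    (@positive_modes_inj C N).
  have -> : ('i *: A) *m (positive_modes C N *m y) - positive_modes C N *m y
      = 'i *: (V *m (positive_modes C N *m y)).
    rewrite -scalemxAl mulmxDl scalerDr chain_positive_modes.
    by rewrite addrAC subrr add0r.
  by rewrite nsqZ normCi expr1n mul1r opnorm_le_nsq.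
have E0r : E 0%N \is Num.real := Er (Ordinal (ltnW (ltnW n3))).
have E2r : E 2%N \is Num.real := Er (Ordinal n3).
rewrite real_leNgt ?realB ?real1 ?(ger0_real eps0) //.
apply/negP => lt2.
pose f : 'I_3 -> 'I_(2 ^ N) := widen_ord n3.
(* Indexed by [nat], with junk value 0 from [N.-1] on, because [joint_kernel_dim] drops the
   operators one at a time. *)
pose B k := if insub k is Some j then U *m mode (u j) *m U ^t* else 0.
have BE k (hk : (k < N.-1)%N) : B k = U *m mode (u (Ordinal hk)) *m U ^t*.
  by rewrite /B insubT.
suff : (2 ^ N.-1 * 3 <= 2 ^ N)%N.
  by case: N N2 => // N' _ /=; rewrite expnS mulnC leq_pmul2r // expn_gt0.
(* The rows of [rowsub f 1%:M] are the three lowest eigenstates; multiplying rows by [B k] on the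
   right stands for its adjoint acting on states. *)
apply: (@joint_kernel_dim C _ _ _ B (rowsub f 1%:M)).
- move=> i j hi hj; rewrite !BE.
  set ui := u _; set uj := u _.
  have -> : (U *m mode ui *m U ^t* ) ^t* = U *m mode (map_mx Num.conj ui) *m U ^t*.
    by rewrite !adjmxM trmxCK mode_adj mulmxA.
  rewrite !conj_unitaryM // -mulmxDl -mulmxDr mode_anticomm map_trmx u_on.
  by rewrite mul_mx_scalar -scalemxAl UU scalemx1.
- move=> k hk; rewrite mul_rowsub_mx mul1mx BE; set j := Ordinal hk.
  (* Entrywise this reads [(E a - E b - lam) * B a b = 0]. For [a] among the three lowest levels,
     [E a - E b <= E 2 - E 0 < 1 - eps <= lam], so the entry of [B] vanishes. *)
  have comm : diag_mx (\row_i E i) *m (U *m mode (u j) *m U ^t* )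
      - (U *m mode (u j) *m U ^t* ) *m diag_mx (\row_i E i)
      = lam j *: (U *m mode (u j) *m U ^t* ).
    rewrite -Ud !conj_unitaryM // -mulmxBl -mulmxBr hatV_comm_mode // scalemxAl u_eig modeZ.
    by rewrite -scalemxAr -scalemxAl.
  apply/matrixP => a b; rewrite !mxE; set X := _ *m _ *m _ in comm.
  have /matrixP/(_ (f a) b) := comm.
  rewrite [LHS]mxE mul_diag_mx [X in _ + X]mxE mul_mx_diag !mxE => /eqP.
  rewrite -subr_eq0 [_ * E b]mulrC -!mulrBl mulf_eq0 => /orP[/eqP h|/eqP //].
  exfalso.
  have hb : E 0%N <= E b by apply: Emono.
  have ha : E (f a) <= E 2%N by apply: Emono => //; rewrite /f /= -ltnS.
  have : lam j < 1 - eps.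
    have -> : lam j = E (f a) - E b by apply/eqP; rewrite eq_sym -subr_eq0 h.
    apply: le_lt_trans lt2; exact: lerB.
  by move/lt_geF; rewrite lam_ge.
- apply/row_freeP; exists (colsub f 1%:M).
  apply/matrixP => a b; rewrite mul_rowsub_mx mul1mx !mxE.
  by congr (_%:R); rewrite -val_eqE.
Qed.

End Gaps.

(** Since [1 + eps <= 2], [eps] is at most [2 * eps / (1 + eps)]; and [r.+1 <= 2 * r] gives
    [N <= 2 * r * m.+1], so the [2r]-th power of the left side is at most [eps ^+ N]. *)
Lemma geometric_rate_le (C : numClosedFieldType) (N r m : nat) (eps : C) :
  (1 <= r)%N -> 0 <= eps -> eps < 1 -> (2 * N <= m.+1 * r.+1)%N ->
  eps ^+ m.+1 <= (2 * r).-root ((2 * eps / (1 + eps)) ^+ N).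
Proof.
move=> r1 e0 e1 hm.
have r20 : (0 < 2 * r)%N by lia.
have em0 : 0 <= eps ^+ m.+1 by rewrite exprn_ge0.
rewrite -(exprCK r20 em0) ler_rootCl ?nnegrE ?exprn_ge0 //.
have e1' : 0 < 1 + eps by rewrite ltr_wpDr.
have le1 : eps <= 2 * eps / (1 + eps).
  rewrite ler_pdivlMr // mulrC ler_wpM2r //.
  by rewrite -[2]/(1 + 1) lerD2l ltW.
apply: (@le_trans _ _ (eps ^+ N)).
  rewrite -exprM ler_wiXn2l ?(ltW e1) //; nia.
by rewrite lerXn2r // nnegrE ?mulr_ge0 ?invr_ge0 ?(ltW e1').
Qed.

Theorem mainTheorem1 (C : numClosedFieldType) (HC : real_complete C)
    (r : nat) (eps : C) :
  (1 <= r)%N -> 0 <= eps -> eps < 1 ->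
  exists N0 : nat, forall N : nat, (N0 <= N)%N -> (2 <= N)%N ->
    forall V : 'M[C]_(2 * N),
      real_antisym V -> opnorm_le V eps -> has_range V r ->
      forall E : nat -> C, sorted_eigenvalues (Ham V) E ->
        E 1%N - E 0%N <= (2 * r).-root ((2 * eps / (1 + eps)) ^+ N) /\
        E 2%N - E 1%N >= 1 - eps - (2 * r).-root ((2 * eps / (1 + eps)) ^+ N).
Proof.
move=> r1 e0 e1; exists 0%N => N _ N2 V Vas Vnorm Vrange E hE.
set delta := _.-root _.
(* The largest [m] with [m * r.+1 < 2 * N]; the predecessor makes this inequality strict. *)
pose m := ((2 * N).-1 %/ r.+1)%N.
have hm : (m * r.+1 < 2 * N)%N.
  by have := leq_divM (2 * N).-1 r.+1; rewrite -/m; lia.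
have hm1 : (2 * N <= m.+1 * r.+1)%N.
  by have := @ltn_ceil (2 * N).-1 r.+1 isT; rewrite -/m; lia.
have gap1 : E 1%N - E 0%N <= delta.
  apply: le_trans _ (geometric_rate_le r1 e0 e1 hm1).
  apply: (@first_gap_le C N (chain C N + V) (zero_mode V N2 m) E).
  - exact: ltnW.
  - exact: chain_add_antisym.
  - by rewrite -Ham_hatV.
  - by rewrite exprn_ge0.
  - by move=> p; apply: zero_mode_real.
  - by rewrite -nsq_eq0 gt_eqF // (lt_le_trans ltr01) // nsq_zero_mode_ge1.
  - by rewrite exprAC; apply: (zero_mode_small Vas Vnorm Vrange).
split=> //.
have gap2 := second_gap_ge N2 Vas e0 Vnorm hE.
have -> : E 2%N - E 1%N = (E 2%N - E 0%N) - (E 1%N - E 0%N) by ring.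
exact: lerB.
Qed.
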